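(* Let $X$ be a real Banach space with single-valued normalized duality mapping, let $N\ge1$, let $F_1,\dots,F_N:X\to X$ be accretive operators and $f_1,\dots,f_N\in X$ such that the system $F_i(x)=f_i$, $i=1,\dots,N$, possesses an exact solution $\widehat{x}^*$. Assume that the $F_i$ are Fréchet differentiable in the closed ball $B_r(\widehat{x}^* )\subset X$ with center $\widehat{x}^*$ and radius $r>0$, and that for some constant $K$ $$\|F_i'(x)-F_i'(y)\|\le K\|x-y\|\quad\text{for all }x,y\in B_r(\widehat{x}^* ),\ i=1,\dots,N.$$ Let $\{\alpha_n\}_{n\ge0}$ be a sequence of real numbers with $\alpha_n>0$, $\alpha_n\to0$ and $1\le\frac{\alpha_n}{\alpha_{n+1}}\le\rho$ for all $n$, where $\rho>1$ is a constant. Assume that the points $x_i^0\in B_r(\widehat{x}^* )$ satisfy $$x_i^0-\widehat{x}^*=F_i'(\widehat{x}^* )v_i,\qquad v_i\in X,\quad i=1,\dots,N.$$ For noise levels $\delta,h>0$ let $f_i^\delta\in X$ and let $F_i^h:X\to X$ be accretive operators, Fréchet differentiable in $B_r(\widehat{x}^* )$, such that for $i=1,\dots,N$ $$\|f_i^\delta-f_i\|\le\delta,\qquad \|F_i^{h\prime}(x)-F_i^{h\prime}(y)\|\le K\|x-y\|\ \ \text{for all }x,y\in B_r(\widehat{x}^* ),$$ $$\|F_i^h(\widehat{x}^* )-F_i(\widehat{x}^* )\|\le h,\qquad \|F_i^{h\prime}(\widehat{x}^* )-F_i'(\widehat{x}^* )\|\le h.$$ Given $x_0\in B_r(\widehat{x}^*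 )$, define $\{x_n\}$ for $n=0,1,2,\dots$ by $$F_i^h(x_n)-f_i^\delta+\frac{\alpha_n}{N}(x_n-x_i^0)+\Big(F_i^{h\prime}(x_n)+\frac{\alpha_n}{N}I\Big)(x_n^i-x_n)=0,\quad i=1,\dots,N,\qquad x_{n+1}=\frac1N\sum_{i=1}^N x_n^i,$$ and define the stopping index $$N(\delta,h)=\max\Big\{n:\alpha_n^2\ge\frac{\delta+h}{\eta}\Big\},$$ where $\eta>0$ is a fixed parameter. If $\sum_{i=1}^N\|v_i\|$ is sufficiently small and $x_0$ is close enough to $\widehat{x}^*$, then $$\|x_n-\widehat{x}^*\|=O(\alpha_n),\qquad n=1,2,\dots,N(\delta,h).$$
   Context: The normalized duality mapping $J:X\to X^*$ satisfies $\langle x,J(x)\rangle=\|x\|^2=\|J(x)\|^2$ for all $x\in X$; it is assumed single valued. An operator $A:X\to X$ is accretive if $\langle A(x)-A(y),J(x-y)\rangle\ge 0$ for all $x,y\in X$. $I$ is the identity operator. $F_i'$ and $F_i^{h\prime}$ denote the Fréchet derivatives of $F_i$ and $F_i^h$. The noise levels are such that $\alpha_0^2\ge(\delta+h)/\eta$, so that $N(\delta,h)$ is defined. $O(\alpha_n)$ means bounded by $C\alpha_n$ with a constant $C$ independent of $n$, $\delta$ and $h$.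
   Formalization: The fixed parameter η is required to be sufficiently small (0 < η ≤ η0, with η0 depending only on the noise-free data) instead of being an arbitrary positive number, since the claim fails for large η. *)

(* Defs.v *)
(* MathComp-Analysis, over an arbitrary realType. *)
From HB Require Import structures.
From mathcomp Require Import all_boot all_order all_algebra.
From mathcomp Require Import all_classical all_reals all_analysis.

Set Implicit Arguments.
Unset Strict Implicit.
Unset Printing Implicit Defensive.

Import Order.TTheory GRing.Theory Num.Theory.
Import numFieldNormedType.Exports.

Local Open Scope classical_set_scope.
Local Open Scope ring_scope.

(* Extended-real valued, so that an upper bound [opnorm T <= c%:E] also says
   that the linear map T is bounded. *)
Definition opnorm (R : realType) (V W : normedModType R) (T : V -> W) : \bar R :=
  ereal_sup [set (`|T u|)%:E | u in [set u : V | `|u| <= 1]].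

Definition normalized_duality (R : realType) (X : normedModType R) (x : X) :
    set {linear X -> R^o} :=
  [set j : {linear X -> R^o} | [/\ continuous j, j x = `|x| ^+ 2
    & ((opnorm j) ^+ 2)%E = (`|x| ^+ 2)%:E]].

Definition single_valued_duality (R : realType) (X : normedModType R)
    (J : X -> {linear X -> R^o}) : Prop :=
  forall x : X, normalized_duality x = [set J x].

Definition accretive (R : realType) (X : normedModType R)
    (J : X -> {linear X -> R^o}) (A : X -> X) : Prop :=
  forall x y : X, 0 <= J (x - y) (A x - A y).

Definition is_stopping_index (R : realType) (alpha : nat -> R)
    (eta delta h : R) (m : nat) : Prop :=
  (delta + h) / eta <= alpha m ^+ 2 /\
  forall n : nat, (delta + h) / eta <= alpha n ^+ 2 -> (n <= m)%N.

(* Main.v *)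
Require Import Defs.
From HB Require Import structures.
From mathcomp Require Import all_boot all_order all_algebra.
From mathcomp Require Import all_classical all_reals all_analysis.
From mathcomp Require Import ring lra.

Set Implicit Arguments.
Unset Strict Implicit.
Unset Printing Implicit Defensive.

Import Order.TTheory GRing.Theory Num.Theory.
Import numFieldNormedType.Exports.

Local Open Scope classical_set_scope.
Local Open Scope ring_scope.

(** The theorem is an induction on the ratio of the error to alpha.  Let e be
    the norm of x_n - xhat, let beta = alpha_n / N, let T be the derivative of
    the noisy operator at x_n, and let w be the difference of the i-th component
    of the Newton step and xhat.  Rearranging the defining equation gives
      (T + beta I) w = g + beta F_i'(xhat) v_i,
    where g collects the Taylor remainder at x_n and the two noise terms, so that
    |g| <= |K| e^2 + delta + h.

    Accretivity survives differentiation in the form of the resolvent estimate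
    beta |u| <= |T u + beta u| ([accretive_diff_resolvent]); hence g contributes
    at most |g| / beta to w.  The source term is treated by comparison with
    beta T v_i.  The vector w - beta v_i solves the same equation with
    right-hand side g + beta (F_i'(xhat) - T) v_i - beta^2 v_i, and
    |F_i'(xhat) - T| <= h + |K| e, so v_i contributes O(alpha_n + h + e) |v_i|
    ([regularized_solution_le], [newton_component_le]).

    Up to the stopping index delta + h <= eta alpha_n^2.  So, when e <= C alpha_n,
    every component, and therefore the average x_{n+1}, is within
      alpha_n (N (|K| C^2 + eta) + (eta alpha_0 + |K| C + 2) S)
    of xhat, with S the sum of the |v_i|.  The bound |K| C^2 is quadratic in C:
    fixing C small first, then eta, then S, makes each of the three parts at most
    C / (4 rho), and alpha_n <= rho alpha_{n+1} returns C alpha_{n+1}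
    ([rate_step]).  A small C also keeps C alpha_0 <= r, so that the iterates
    never leave the ball where the operators are differentiable.

    The Taylor remainder of a map with values in X is bounded without integrals:
    the duality functional of the remainder is norming for it, which reduces the
    claim to the mean value theorem on the real line ([newton_remainder_le]). *)

(** * Operator norms and the duality mapping *)

Lemma scalable_opnorm_le (R : realType) (V W : normedModType R) (T : V -> W)
    (c : R) : scalable T -> (opnorm T <= c%:E)%E ->
  forall u, `|T u| <= c * `|u|.
Proof.
move=> Tlin Tc u; have [->|u0] := eqVneq u 0.
  by rewrite -(scale0r 0) Tlin !scale0r !normr0 mulr0.
have nu : 0 < `|u| by rewrite normr_gt0.
have Tu : `|T (`|u|^-1 *: u)| = `|T u| / `|u|.
  by rewrite Tlin normrZ ger0_norm ?invr_ge0// mulrC.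
rewrite -ler_pdivrMr// -Tu -lee_fin.
move/ereal_supP : Tc; apply; exists (`|u|^-1 *: u) => //=.
by rewrite normrZ ger0_norm ?invr_ge0// mulVf ?gt_eqF.
Qed.

Lemma linear_opnormB_le (R : realType) (V W : normedModType R)
    (S T : {linear V -> W}) (c : R) :
  (opnorm (fun u => S u - T u)%R <= c%:E)%E ->
  forall u, `|S u - T u| <= c * `|u|.
Proof.
apply: scalable_opnorm_le => a u.
by rewrite scalerBr; congr (_ - _); exact: linearZ.
Qed.

Lemma duality_map_continuous (R : realType) (X : normedModType R)
    (J : X -> {linear X -> R^o}) (x : X) :
  single_valued_duality J -> continuous (J x).
Proof.
by move=> hJ; have [] : normalized_duality x (J x) by rewrite hJ.
Qed.

Lemma duality_map_diag (R : realType) (X : normedModType R)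
    (J : X -> {linear X -> R^o}) (x : X) :
  single_valued_duality J -> J x x = `|x| ^+ 2.
Proof.
by move=> hJ; have [] : normalized_duality x (J x) by rewrite hJ.
Qed.

Lemma duality_map_norm_le (R : realType) (X : normedModType R)
    (J : X -> {linear X -> R^o}) (x u : X) :
  single_valued_duality J -> `|J x u| <= `|x| * `|u|.
Proof.
move=> hJ; have [_ _ Jnorm] : normalized_duality x (J x) by rewrite hJ.
apply: scalable_opnorm_le; first by move=> a w; rewrite linearZ.
have := sqrte_sqr (opnorm (J x)); rewrite Jnorm /= sqrtr_sqr normr_id => ->.
exact: lee_abs.
Qed.

(** * Accretive operators and their derivatives *)

(** The functional J (x - y) sends x - y + l (A x - A y) to at least
    |x - y|^2 and has norm |x - y|. *)
Lemma accretive_resolvent (R : realType) (X : normedModType R)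
    (J : X -> {linear X -> R^o}) (A : X -> X) (x y : X) (l : R) :
  single_valued_duality J -> accretive J A -> 0 <= l ->
  `|x - y| <= `|x - y + l *: (A x - A y)|.
Proof.
move=> hJ hA l0; have [->|d0] := eqVneq (x - y) 0; first by rewrite normr0.
rewrite -(@ler_pM2l _ `|x - y|) ?normr_gt0// -expr2.
apply: le_trans (duality_map_norm_le _ _ hJ).
rewrite linearD linearZ /= (duality_map_diag _ hJ).
apply: le_trans (ler_norm _).
by rewrite lerDl mulr_ge0.
Qed.

(** Apply [accretive_resolvent] to p + t w and p with l = 1 / b, divide by |t|,
    and let t tend to 0.  This is possible for a merely single-valued J, of which
    no trace is left in the inequality between norms. *)
Lemma accretive_diff_resolvent (R : realType) (X : normedModType R)
    (J : X -> {linear X -> R^o}) (A : X -> X) (p w : X) (b : R) :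
  single_valued_duality J -> accretive J A -> differentiable A p -> 0 < b ->
  b * `|w| <= `|'d A p w + b *: w|.
Proof.
move=> hJ hA dA b0.
pose q t : X := t^-1 *: ((A \o shift p) (t *: w) - A p).
have qcvg : q t @[t --> 0^'] --> ('d A p w : X).
  by rewrite -deriveE//; exact: (@diff_derivable _ _ _ A p w dA).
have ncvg : `|q t + b *: w| @[t --> 0^'] --> `|('d A p w : X) + b *: w|.
  by apply: cvg_norm; apply: cvgD => //; exact: cvg_cst.
rewrite -(cvg_lim _ ncvg)//; apply: limr_ge; first by apply/cvg_ex; eexists; exact: ncvg.
near=> t; have t0 : t != 0 by near: t; exact: nbhs_dnbhs_neq.
have := @accretive_resolvent R X J A (t *: w + p) p b^-1 hJ hA.
rewrite addrK => /(_ (ltW _)); rewrite invr_gt0 => /(_ b0).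
have -> : t *: w + b^-1 *: (A (t *: w + p) - A p) = (t / b) *: (q t + b *: w).
  rewrite /q [RHS]scalerDr !scalerA mulrAC divff// mul1r.
  by rewrite divfK ?gt_eqF// addrC.
rewrite !normrZ normfV (gtr0_norm b0) -mulrA.
by rewrite ler_pM2l ?normr_gt0// ler_pdivlMl.
Unshelve. all: by end_near. Qed.

(** * Taylor remainder of a map with Lipschitz derivative *)

Lemma diff_mean_value (R : realType) (X : normedModType R) (F : X -> X)
    (phi : {linear X -> R^o}) (p d : X) :
  continuous phi ->
  (forall t : R, 0 <= t <= 1 -> differentiable F (t *: d + p)) ->
  exists2 c : R, 0 <= c <= 1 &
    phi (F (d + p) - F p) = phi ('d F (c *: d + p) d).
Proof.
move=> phic dF.
pose g (t : R) : X := t *: d + p.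
pose psi : R -> R := phi \o (F \o g).
have dg (t : R) : is_diff t g ( *:%R^~ d).
  by rewrite -[X in is_diff _ _ X]addr0; apply: is_diffD.
have dpsi (t : R) : 0 <= t <= 1 ->
    is_diff t psi (phi \o ('d F (g t) \o ( *:%R^~ d))).
  move=> t01; apply: is_diff_comp.
    apply: is_diff_comp; apply: DiffDef => //; exact: dF.
  by apply: DiffDef; [exact: linear_differentiable|exact: diff_lin].
have [||c c01 E] := @MVT R psi (fun t => phi ('d F (g t) d)) 0 1 ltr01.
- move=> t; rewrite in_itv/= => /andP[t0 t1].
  have [] := dpsi t; first by rewrite !ltW.
  move=> D1 D2; apply: DeriveDef; first exact: diff_derivable.
  by rewrite deriveE// D2 /= scale1r.
- apply: continuous_in_subspaceT => t; rewrite inE /= in_itv/= => t01.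
  have [D _] := dpsi t t01; exact: differentiable_continuous.
move: c01; rewrite in_itv/= => /andP[c0 c1].
exists c; first by rewrite !ltW.
by move: E; rewrite /psi /g /= subr0 mulr1 scale1r scale0r add0r linearB.
Qed.

(** The expansion uses the derivative at the moving point x, as Newton's method
    does, not the derivative at p.  For u the remainder, J u attains |u|^2 at u,
    so a mean value point on the segment gives
    |u|^2 <= |u| |F'(c) - F'(x)| |x - p|. The absolute value of K covers a
    negative K, which is possible only in the trivial space. *)
Lemma newton_remainder_le (R : realType) (X : normedModType R)
    (J : X -> {linear X -> R^o}) (F : X -> X) (p x : X) (r K : R) :
  single_valued_duality J -> 0 < r ->
  (forall y, closed_ball p r y -> differentiable F y) ->
  (forall y z, closed_ball p r y -> closed_ball p r z ->
     (opnorm (fun u => 'd F y u - 'd F z u)%R <= (K * `|y - z|)%:E)%E) ->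
  closed_ball p r x ->
  `|F x - F p - 'd F x (x - p)| <= `|K| * `|x - p| ^+ 2.
Proof.
move=> hJ r0 dF lipF xr; set d := x - p.
have xE : x = d + p by rewrite /d subrK.
have dr : `|d| <= r by move: xr; rewrite closed_ballE// /closed_ball_ /= distrC.
have seg (t : R) : 0 <= t <= 1 -> closed_ball p r (t *: d + p).
  move=> /andP[t0 t1]; rewrite closed_ballE// /closed_ball_ /=.
  rewrite opprD addrCA subrr addr0 normrN normrZ ger0_norm//.
  by apply: le_trans dr; rewrite ler_piMl.
set u := F x - F p - 'd F x d.
have [->|u0] := eqVneq u 0; first by rewrite normr0 mulr_ge0// sqr_ge0.
have [c c01 E] := @diff_mean_value R X F (J u) p d (duality_map_continuous hJ)
  (fun t t01 => dF _ (seg t t01)).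
have uE : `|u| ^+ 2 = J u ('d F (c *: d + p) d - 'd F x d).
  by rewrite -(duality_map_diag u hJ) [RHS]linearB -E -xE -linearB.
rewrite -(@ler_pM2l _ `|u|) ?normr_gt0// -expr2 uE.
apply: le_trans (ler_norm _) _.
apply: le_trans (duality_map_norm_le _ _ hJ) _.
rewrite ler_wpM2l//.
apply: le_trans (linear_opnormB_le (lipF _ _ (seg _ c01) xr) d) _.
rewrite expr2 mulrA ler_wpM2r//.
apply: (@le_trans _ _ (`|K| * `|c *: d + p - x|)).
  by rewrite ler_wpM2r// ler_norm.
rewrite ler_wpM2l// xE opprD addrACA subrr addr0.
case/andP: c01 => c0 c1.
rewrite -{2}(scale1r d) -scalerBl normrZ ler_piMl// ler_norml; lra.
Qed.

(** * One step of the method *)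

(** When q = T v the solution of (T + b I) w = b q is b v - b^2 (T + b I)^-1 v,
    of size 2 b |v|: a source in the range of T gains a factor b over the bare
    resolvent bound.  Subtracting b v from w achieves this without inverting
    T + b I, and the defect q - T v is handled by the resolvent bound. *)
Lemma regularized_solution_le (R : realType) (X : normedModType R)
    (T : {linear X -> X}) (b m : R) (w g v q : X) :
  0 < b -> (forall u, b * `|u| <= `|T u + b *: u|) ->
  T w + b *: w = g + b *: q -> `|q - T v| <= m * `|v| ->
  `|w| <= `|g| / b + (m + b + b) * `|v|.
Proof.
move=> b0 hT Ew hq.
pose u := w - b *: v.
have Eu : T u + b *: u = g + b *: (q - T v) - b *: (b *: v).
  rewrite /u linearB linearZ /= scalerBr addrACA Ew -opprD opprD addrA.
  by rewrite scalerBr addrA.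
have : b * `|u| <= `|g| + b * (m * `|v|) + b * (b * `|v|).
  apply: le_trans (hT u) _; rewrite Eu.
  apply: le_trans (ler_normB _ _) _; apply: lerD.
    apply: le_trans (ler_normD _ _) _; rewrite lerD2l normrZ gtr0_norm//.
    by rewrite ler_pM2l.
  by rewrite !normrZ !gtr0_norm.
have -> : `|g| + b * (m * `|v|) + b * (b * `|v|) =
  b * (`|g| / b + m * `|v| + b * `|v|) by field; rewrite gt_eqF.
rewrite ler_pM2l// => hu.
have : `|w| <= `|u| + `|b *: v| by rewrite -{1}(subrK (b *: v) w) ler_normD.
rewrite normrZ gtr0_norm// => hw; lra.
Qed.

(** Here G is the noisy version of F, x the current iterate, x0 the reference
    point of the regularization and y the component of the Newton step. *)
Lemma newton_component_le (R : realType) (X : normedModType R)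
    (J : X -> {linear X -> R^o}) (F G : X -> X) (p v x0 x y fd : X)
    (r K b delta h : R) :
  single_valued_duality J -> 0 < r -> 0 < b -> accretive J G ->
  (forall z, closed_ball p r z -> differentiable G z) ->
  (forall y z, closed_ball p r y -> closed_ball p r z ->
     (opnorm (fun u => 'd G y u - 'd G z u)%R <= (K * `|y - z|)%:E)%E) ->
  `|fd - F p| <= delta -> `|G p - F p| <= h ->
  (opnorm (fun u => 'd G p u - 'd F p u)%R <= h%:E)%E ->
  x0 - p = 'd F p v -> closed_ball p r x ->
  G x - fd + b *: (x - x0) + ('d G x (y - x) + b *: (y - x)) = 0 ->
  `|y - p| <= (`|K| * `|x - p| ^+ 2 + (delta + h)) / b
              + (h + `|K| * `|x - p| + b + b) * `|v|.
Proof.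
move=> hJ r0 b0 hG dG lipG hfd hGF hdGF hv xr step.
pose g := fd - G x + 'd G x (x - p).
have Eg : 'd G x (y - p) + b *: (y - p) = g + b *: ('d F p v).
  have -> : y - p = (y - x) + (x - p) by rewrite subrKA.
  have bxp : b *: (x - p) = b *: (x - x0) + b *: (x0 - p).
    by rewrite -scalerDr subrKA.
  move/eqP: step; rewrite addrC addr_eq0 => /eqP step.
  rewrite -hv linearD scalerDr bxp addrACA step opprD opprB.
  by rewrite [_ + (_ + b *: (x0 - p))]addrCA subrKA addrA.
have ng : `|g| <= `|K| * `|x - p| ^+ 2 + (delta + h).
  have -> : g = (fd - F p) - (G p - F p) - (G x - G p - 'd G x (x - p)).
    rewrite opprB addrA subrK [in RHS]opprB opprB addrCA.
    by rewrite [fd - _ + _]addrA subrK addrC.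
  apply: le_trans (ler_normB _ _) _; rewrite addrC; apply: lerD.
    exact: newton_remainder_le hJ r0 dG lipG xr.
  by apply: le_trans (ler_normB _ _) _; exact: lerD.
have pr : closed_ball p r p by exact: closed_ballxx.
have hq : `|'d F p v - 'd G x v| <= (h + `|K| * `|x - p|) * `|v|.
  rewrite -(subrKA ('d G p v)) mulrDl; apply: le_trans (ler_normD _ _) _.
  apply: lerD; first by rewrite distrC; exact: linear_opnormB_le hdGF v.
  rewrite distrC; apply: le_trans (linear_opnormB_le (lipG _ _ xr pr) v) _.
  by rewrite ler_wpM2r// ler_wpM2r// ler_norm.
apply: le_trans (regularized_solution_le b0 _ Eg hq) _.
  by move=> u; exact: accretive_diff_resolvent hJ hG (dG _ xr) b0.
by rewrite lerD2r ler_pM2r ?invr_gt0.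
Qed.

(** The arithmetic of the induction: the three smallness conditions bound in
    turn the contributions of the quadratic Newton error, the noise and the source
    elements by a quarter of C / rho times a. *)
Lemma rate_step (R : realFieldType) (n L e dh h v a a' a0 eta rho C S : R) :
  1 <= n -> 0 <= L -> 0 <= e -> 0 <= v <= S -> 0 < a <= a0 -> 0 < eta ->
  0 < C -> 0 < rho -> 0 <= h <= dh -> dh <= eta * a ^+ 2 ->
  a <= rho * a' -> e <= C * a ->
  rho * n * L * C <= 4^-1 -> rho * n * eta <= C / 4 ->
  rho * (eta * a0 + L * C + 2) * S <= C / 4 ->
  (L * e ^+ 2 + dh) / (a / n) + (h + L * e + a / n + a / n) * v <= C * a'.
Proof.
move=> n1 L0 e0 /andP[v0 vS] /andP[a_gt0 aa0] eta_gt0 C_gt0 rho_gt0 /andP[h0 hdh].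
move=> dhle aa' eC c1 c2 c3.
have n_gt0 : 0 < n by exact: lt_le_trans n1.
have e2 : e ^+ 2 <= C ^+ 2 * a ^+ 2.
  by rewrite -exprMn lerXn2r// nnegrE ltW// mulr_gt0.
have t1 : (L * e ^+ 2 + dh) / (a / n) <= a * (n * (L * C ^+ 2 + eta)).
  rewrite ler_pdivrMr ?divr_gt0//.
  have -> : a * (n * (L * C ^+ 2 + eta)) * (a / n) =
      L * (C ^+ 2 * a ^+ 2) + eta * a ^+ 2.
    by field; rewrite gt_eqF.
  by rewrite lerD// ler_wpM2l.
have an : a / n <= a by rewrite ler_pdivrMr// ler_peMr// ltW.
have hle : h <= eta * a0 * a.
  apply: le_trans hdh _; apply: le_trans dhle _.
  by rewrite -mulrA expr2 ler_pM2l// ler_wpM2r// ltW.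
have Le : L * e <= L * C * a by rewrite -mulrA ler_wpM2l.
have t2 : (h + L * e + a / n + a / n) * v <= a * ((eta * a0 + L * C + 2) * S).
  have an0 : 0 <= a / n by rewrite divr_ge0 // ltW.
  rewrite mulrA; apply: ler_pM => //; first by rewrite !addr_ge0// mulr_ge0.
  have -> : a * (eta * a0 + L * C + 2) = eta * a0 * a + L * C * a + a + a by ring.
  by rewrite !lerD.
(* A quarter each from the three conditions, hence at most 3 C / 4. *)
have tot : rho * (n * (L * C ^+ 2 + eta) + (eta * a0 + L * C + 2) * S) <= C.
  have : rho * n * L * C * C <= 4^-1 * C by rewrite ler_pM2r.
  have -> : rho * (n * (L * C ^+ 2 + eta) + (eta * a0 + L * C + 2) * S) =
    rho * n * L * C * C + rho * n * eta + rho * (eta * a0 + L * C + 2) * S by ring.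
  lra.
have a'0 : 0 < a' by rewrite -(pmulr_rgt0 _ rho_gt0); exact: lt_le_trans aa'.
apply: le_trans (lerD t1 t2) _; rewrite -mulrDr.
set Q := (X in a * X) in tot *.
have Q0 : 0 <= Q.
  rewrite /Q addr_ge0// mulr_ge0 ?addr_ge0 ?mulr_ge0 ?sqr_ge0//
    ?(ltW n_gt0) ?(ltW eta_gt0) ?(ltW C_gt0)//.
  - by rewrite ltW//; exact: lt_le_trans aa0.
  - exact: le_trans vS.
apply: (@le_trans _ _ (rho * a' * Q)); first by rewrite ler_wpM2r.
by rewrite mulrAC ler_pM2r.
Qed.

Lemma ler_norm_mean (R : realType) (X : normedModType R) (N : nat)
    (w : 'I_N -> X) (p : X) (M : R) : (0 < N)%N ->
  (forall i, `|w i - p| <= M) -> `|N%:R^-1 *: \sum_(i < N) w i - p| <= M.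
Proof.
move=> N0 wM.
have NR : 0 < N%:R :> R by rewrite ltr0n.
have -> : N%:R^-1 *: \sum_(i < N) w i - p = N%:R^-1 *: \sum_(i < N) (w i - p).
  rewrite sumrB sumr_const card_ord scalerBr -[p *+ N]scaler_nat scalerA mulVf ?gt_eqF//.
  by rewrite scale1r.
rewrite normrZ gtr0_norm ?invr_gt0// ler_pdivrMl//.
apply: le_trans (ler_norm_sum _ _ _) _.
apply: le_trans (ler_sum _ (fun i _ => wM i)) _.
by rewrite sumr_const card_ord mulr_natl.
Qed.

(** * Convergence rate *)

Theorem theorem2 (R : realType) (X : completeNormedModType R)
  (J : X -> {linear X -> R^o}) (hJ : single_valued_duality J)
  (N : nat) (hN : (1 <= N)%N)
  (F : 'I_N -> X -> X) (f : 'I_N -> X) (xhat : X)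
  (hFacc : forall i, accretive J (F i))
  (hsol : forall i, F i xhat = f i)
  (r : R) (hr : 0 < r)
  (hFdiff : forall i x, closed_ball xhat r x -> differentiable (F i) x)
  (K : R)
  (hFlip : forall i x y, closed_ball xhat r x -> closed_ball xhat r y ->
     (opnorm (fun u => 'd (F i) x u - 'd (F i) y u)%R <= (K * `|x - y|)%:E)%E)
  (alpha : nat -> R) (rho : R)
  (halpha_gt0 : forall n, 0 < alpha n)
  (halpha_cvg : alpha n @[n --> \oo] --> (0 : R))
  (hrho : 1 < rho)
  (halpha_ratio : forall n, 1 <= alpha n / alpha n.+1 <= rho) :
  exists eta0 : R, 0 < eta0 /\
  forall eta : R, 0 < eta <= eta0 ->
  exists eps1 eps2 C : R, [/\ 0 < eps1, 0 < eps2 &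
    forall (xi0 v : 'I_N -> X),
    (forall i, closed_ball xhat r (xi0 i)) ->
    (forall i, xi0 i - xhat = 'd (F i) xhat (v i)) ->
    \sum_(i < N) `|v i| <= eps1 ->
    forall (delta h : R), 0 < delta -> 0 < h ->
    (delta + h) / eta <= alpha 0%N ^+ 2 ->
    forall (fd : 'I_N -> X) (Fh : 'I_N -> X -> X),
    (forall i, accretive J (Fh i)) ->
    (forall i x, closed_ball xhat r x -> differentiable (Fh i) x) ->
    (forall i, `|fd i - f i| <= delta) ->
    (forall i x y, closed_ball xhat r x -> closed_ball xhat r y ->
       (opnorm (fun u => 'd (Fh i) x u - 'd (Fh i) y u)%R <= (K * `|x - y|)%:E)%E) ->
    (forall i, `|Fh i xhat - F i xhat| <= h) ->
    (forall i, (opnorm (fun u => 'd (Fh i) xhat u - 'd (F i) xhat u)%R <= h%:E)%E) ->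
    forall (Nstop : nat), is_stopping_index alpha eta delta h Nstop ->
    forall (x : nat -> X) (xi : nat -> 'I_N -> X),
    closed_ball xhat r (x 0%N) ->
    (forall n, (n < Nstop)%N ->
       (forall i,
          Fh i (x n) - fd i + (alpha n / N%:R) *: (x n - xi0 i)
          + ('d (Fh i) (x n) (xi n i - x n)
             + (alpha n / N%:R) *: (xi n i - x n)) = 0)
       /\ x n.+1 = N%:R^-1 *: \sum_(i < N) xi n i) ->
    `|x 0%N - xhat| <= eps2 ->
    forall n, (1 <= n <= Nstop)%N -> `|x n - xhat| <= C * alpha n].
Proof.
have a0_gt0 := halpha_gt0 0%N.
have N_gt0 : 0 < N%:R :> R by rewrite ltr0n.
have rho_gt0 : 0 < rho by exact: lt_trans hrho.
set L := `|K|; have L0 : 0 <= L by exact: normr_ge0.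
(* The first bound keeps the iterates in the ball, the second absorbs the
   quadratic term; L + 1 replaces L so that the inverse makes sense when L = 0. *)
pose C := Num.min (r / alpha 0%N) (4 * rho * N%:R * (L + 1))^-1.
have L1 : 0 < L + 1 by rewrite ltr_wpDl.
have C_gt0 : 0 < C by rewrite lt_min divr_gt0//= invr_gt0 !mulr_gt0.
have Cr : C * alpha 0%N <= r by rewrite -ler_pdivlMr// ge_min lexx.
have CL : rho * N%:R * L * C <= 4^-1.
  have : C <= (4 * rho * N%:R * (L + 1))^-1 by rewrite ge_min lexx orbT.
  rewrite -[_^-1]mul1r ler_pdivlMr ?mulr_gt0// => h1.
  have : 0 <= rho * N%:R * C by rewrite !mulr_ge0// ltW.
  lra.
exists (C / 4 / (rho * N%:R)); split; first by rewrite !divr_gt0// mulr_gt0.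
move=> eta /andP[eta_gt0 etale].
pose D := eta * alpha 0%N + L * C + 2.
have D_gt0 : 0 < D by rewrite ltr_wpDl// addr_ge0// mulr_ge0// ltW.
exists (C / 4 / (rho * D)), (C * alpha 0%N), C; split.
- by rewrite !divr_gt0// mulr_gt0.
- exact: mulr_gt0.
move=> xi0 v _ hv hS delta h delta_gt0 h_gt0 _ fd Fh hGacc dG hfd lipG hGF hdGF.
move=> Nstop [stop _] x xi _ step x0le.
have alpha_dec n : alpha n.+1 <= alpha n.
  by have /andP[] := halpha_ratio n; rewrite ler_pdivlMr// mul1r.
have alpha_noninc m n : (m <= n)%N -> alpha n <= alpha m.
  elim: n => [|n IHn]; first by rewrite leqn0 => /eqP ->.
  rewrite leq_eqVlt => /predU1P[-> //|]; rewrite ltnS => /IHn.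
  exact: le_trans.
suff rate n : (n <= Nstop)%N -> `|x n - xhat| <= C * alpha n.
  by move=> n /andP[_]; exact: rate.
elim: n => [//|n IHn] nN.
have {IHn} en := IHn (ltnW nN).
have [newton ->] := step n nN.
have xr : closed_ball xhat r (x n).
  rewrite closed_ballE// /closed_ball_ /= distrC.
  apply: le_trans en _; apply: le_trans Cr.
  by rewrite ler_pM2l// alpha_noninc.
apply: ler_norm_mean => // i.
have b_gt0 : 0 < alpha n / N%:R by rewrite divr_gt0.
have hfd' : `|fd i - F i xhat| <= delta by rewrite hsol.
apply: le_trans (newton_component_le hJ hr b_gt0 (hGacc i) (dG i) (lipG i)
  hfd' (hGF i) (hdGF i) (hv i) xr (newton i)) _.
apply: (@rate_step R N%:R L _ (delta + h) h _ _ _ (alpha 0%N) eta rho C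
  (\sum_(i < N) `|v i|)) => //.
- by rewrite ler1n.
- by rewrite normr_ge0/= (bigD1 i)//= lerDl sumr_ge0.
- by rewrite halpha_gt0 alpha_noninc.
- by rewrite ltW//= lerDr ltW.
- rewrite mulrC -ler_pdivrMr//; apply: le_trans stop _.
  by rewrite lerXn2r// ?nnegrE ?(ltW (halpha_gt0 _))// alpha_noninc// ltnW.
- by have /andP[_] := halpha_ratio n; rewrite ler_pdivrMr.
- by rewrite mulrC -ler_pdivlMr// mulr_gt0.
- rewrite -/D mulrC -ler_pdivlMr//; exact: mulr_gt0.
Qed.
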